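(* Let $\Pi$ be a point process on $\mathbb{R}^d$. The following are equivalent. (i) The point process $\Pi$ is deletion-tolerant. (ii) For any finite subprocess $\mathcal{F}$ of $\Pi$, we have $\Pi-\mathcal{F}\prec\Pi$. (iii) For all bounded Borel sets $S\subseteq\mathbb{R}^d$, we have $\Pi|_{S^c}\prec\Pi$. (iv) For all bounded Borel sets $S\subseteq\mathbb{R}^d$, we have $\mathbb{P}\big(\Pi(S)=0\ \big|\ \Pi|_{S^c}\big)>0$ almost surely.
   Context: Point processes are always assumed to be simple and locally finite, i.e. random elements of the space $\mathbb{M}$ of simple locally finite point measures on $\mathbb{R}^d$, equipped with the product $\sigma$-field (generated by the evaluations $\mu\mapsto\mu(A)$, $A$ Borel). The support of $\mu\in\mathbb{M}$ is $[\mu]=\{y\in\mathbb{R}^d:\mu(\{y\})=1\}$. For random variables $X,Y$ with values in the same measurable space, $X\prec Y$ means that the law of $X$ is absolutely continuous with respect to the law of $Y$: $\mathbb{P}(Y\in\mathcal{A})=0$ implies $\mathbb{P}(X\in\mathcal{A})=0$ for all measurable $\mathcal{A}$. For $x\in\mathbb{R}^d$, $\delta_x$ is the point measure at $x$. The restriction of $\mu\in\mathbb{M}$ to a Borel set $S$ is given by $\mu|_S(A)=\mu(A\cap S)$ for Borel $A$, and $S^c=\mathbb{R}^d\setminus S$. A $\Pi$-point is an $\mathbb{R}^d$-valued random variable $Z$ such that $Z\in[\Pi]$ almost surely. A finite subprocess of $\Pi$ is a point process $\mathcal{F}$ such that $\mathcal{F}(\mathbb{R}^d)<\infty$ and $[\mathcal{F}]\subseteq[\Pi]$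 almost surely. $\Pi$ is deletion-tolerant if for any $\Pi$-point $Z$ we have $\Pi-\delta_Z\prec\Pi$.
   Formalization: If Π is empty with probability strictly between 0 and 1, no Π-point exists and (i) is vacuous, so the equivalence can fail; it is proved for Π a.s. nonempty, and for every Π with (i) changed so that Z need lie in [Π] only when Π is nonempty, nothing being deleted otherwise. *)

(* Defs.v *)
From HB Require Import structures.
From mathcomp Require Import all_boot all_order all_algebra.
From mathcomp Require Import finmap.
From mathcomp Require Import all_classical all_reals all_analysis.
From mathcomp Require Import measurable_realfun.

Set Implicit Arguments.
Unset Strict Implicit.
Unset Printing Implicit Defensive.

Import Order.TTheory GRing.Theory Num.Theory.
Import numFieldNormedType.Exports.

Local Open Scope classical_set_scope.
Local Open Scope ring_scope.
Local Open Scope ereal_scope.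

(* R^d with its Borel sigma-algebra; the carrier is convertible to 'rV[R]_d,
   whose norm is the sup norm (same bounded sets as the Euclidean norm). *)
Definition euclid (R : realType) (d : nat) :=
  g_sigma_algebraType (@open 'rV[R]_d).

Section simple_point_measures.
Context (R : realType) (d : nat).
Local Notation E := (euclid R d).

Definition bounded_subset (A : set E) := bounded_set (A : set 'rV[R]_d).

(* X is a set of atoms, not a family, so every atom has mass one. *)
Definition simple_locally_finite (mu : set E -> \bar R) :=
  (exists X : set E,
      forall A, measurable A -> mu A = \esum_(x in X) \d_x A) /\
  (forall A, measurable A -> bounded_subset A -> mu A < +oo).

(* The values of a {measure set E -> \bar R} on non-Borel sets are irrelevant:
   everything below only looks at Borel sets. *)
Record point_measure := PointMeasure {
  pm_measure :> {measure set E -> \bar R} ;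
  pm_simple_locally_finite : simple_locally_finite pm_measure }.

Definition support (mu : point_measure) : set E :=
  [set y | mu [set y] = 1].

Lemma zero_spec : simple_locally_finite (@mzero _ E R).
Proof.
split; last by move=> A _ _; rewrite /mzero ltry.
by exists set0 => A mA; rewrite esum_set0.
Qed.

Definition pm_zero : point_measure := PointMeasure zero_spec.

Lemma dirac_spec (x : E) : simple_locally_finite (@dirac _ E x R).
Proof.
split; first by exists [set x] => A mA; rewrite esum_set1.
by move=> A _ _; rewrite diracE ltry.
Qed.

Definition pm_dirac (x : E) : point_measure := PointMeasure (dirac_spec x).

Lemma restr_spec (mu : point_measure) (S : set E) (mS : measurable S) :
  simple_locally_finite (mrestr mu mS).
Proof.
case: (pm_simple_locally_finite mu) => -[X muX] muoo; split.
- exists (X `&` S) => A mA; rewrite /mrestr muX; last exact: measurableI.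
  rewrite esum_mkcondr; apply: eq_esum => x _.
  rewrite !diracE in_setI; case: (x \in S); first by rewrite andbT.
  by rewrite andbF.
- move=> A mA bA; rewrite /mrestr.
  by apply: le_lt_trans (muoo A mA bA); apply: le_measure => //;
    rewrite inE//; exact: measurableI.
Qed.

Definition pm_restr (S : set E) (mS : measurable S) (mu : point_measure) :
  point_measure := PointMeasure (restr_spec mu mS).

HB.instance Definition _ := gen_eqMixin point_measure.
HB.instance Definition _ := gen_choiceMixin point_measure.
HB.instance Definition _ := isPointed.Build point_measure pm_zero.

Definition pm_measurable : set (set point_measure) :=
  <<s \bigcup_(A in @measurable _ E)
        preimage_set_system [set: point_measure]
          (fun mu : point_measure => mu A)
          (measurable : set (set (\bar R))) >>.

Let pm_measurable0 : pm_measurable set0.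
Proof. exact: sigma_algebra0. Qed.

Let pm_measurableC (U : set point_measure) :
  pm_measurable U -> pm_measurable (~` U).
Proof. exact: sigma_algebraC. Qed.

Let pm_measurableU (F : (set point_measure)^nat) :
  (forall i, pm_measurable (F i)) -> pm_measurable (\bigcup_i F i).
Proof. exact: sigma_algebra_bigcup. Qed.

Definition pm_display : measure_display.
Proof. by constructor. Qed.

HB.instance Definition _ :=
  @isMeasurable.Build pm_display point_measure pm_measurable
    pm_measurable0 pm_measurableC pm_measurableU.

Definition pm_difference (mu nu rho : point_measure) :=
  forall A, measurable A -> rho A = mu A - nu A.

(* mu - nu when that is a simple locally finite point measure (determined on
   Borel sets, which is all that the sigma-algebra of point_measure sees), and
   the zero measure otherwise. *)
Definition pm_sub (mu nu : point_measure) : point_measure :=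
  xget pm_zero [set rho | pm_difference mu nu rho].

Lemma measurable_singleton (x : E) : measurable [set x].
Proof.
rewrite -[X in measurable X]setCK; apply: measurableC.
apply: sub_sigma_algebra => /=; apply: closed_openC.
apply: accessible_closed_set1.
exact: (hausdorff_accessible (@norm_hausdorff R 'rV[R]_d)).
Qed.

Lemma support_atoms (mu : point_measure) (X : set E) :
  (forall A, measurable A -> mu A = \esum_(x in X) \d_x A) ->
  support mu = X.
Proof.
move=> muX; apply/seteqP; split=> x.
- rewrite /support/= muX; last exact: measurable_singleton.
  move=> h; apply: contrapT => nXx; move: h; rewrite esum1 => [/eqP|y Xy].
    by rewrite eq_sym onee_eq0.
  by rewrite diracE memNset//= => yx; apply: nXx; rewrite -yx.
- move=> Xx; rewrite /support/= muX; last exact: measurable_singleton.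
  rewrite (esumID [set x])// (_ : X `&` [set x] = [set x]); last first.
    by apply/seteqP; split=> [y []//|y ->].
  rewrite esum_set1// esum1 ?diracE ?adde0 ?mem_set// => y [_ /= yx].
  by rewrite diracE memNset.
Qed.

Lemma support_finite (mu : point_measure) :
  mu setT < +oo -> finite_set (support mu).
Proof.
case: (pm_simple_locally_finite mu) => -[X muX] _.
rewrite (support_atoms muX) muX// => h.
apply: contrapT => /infinite_set_fset nfin.
have [r muTr] : exists r : R, \esum_(x in X) \d_x setT <= r%:E.
  move: h; case: (\esum_(x in X) \d_x setT) => [r _| |_]//; first by exists r.
  by exists 0%R; rewrite leNye.
have [F FX Fr] := nfin (Num.truncn `|r|%R).+1.
have [S [FS SX finS]] : exists S : set E,
    [/\ fset_set S = F, S `<=` X & finite_set S].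
  by exists [set` F]; split; [exact: set_fsetK|exact: FX|exact: finite_fset].
have sumF : \sum_(x \in S) (\d_x [set: E] : \bar R) =
    ((size (finmap.enum_fset F))%:R)%:E.
  rewrite fsbig_finite// FS.
  under eq_bigr do rewrite diracE in_setT.
  by rewrite sumEFin big_const_seq count_predT iter_addr_0.
have : ((size (finmap.enum_fset F))%:R)%:E <= r%:E.
  by apply: le_trans muTr; rewrite -sumF; apply: esum_ge; exists S.
rewrite lee_fin; apply/negP; rewrite -ltNge.
apply: (le_lt_trans (ler_norm r)); apply: lt_le_trans (truncnS_gt _) _.
by rewrite ler_nat.
Qed.

(* The hypotheses are those that a finite subprocess satisfies almost surely:
   pm_sub is then an actual difference of measures. *)
Lemma pm_subP (mu nu : point_measure) :
  nu setT < +oo -> support nu `<=` support mu ->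
  pm_difference mu nu (pm_sub mu nu).
Proof.
move=> nuT numu.
have finnu := support_finite nuT.
have mS : measurable (support nu).
  exact: (countable_measurable measurable_singleton
    (finite_set_countable finnu)).
have : exists rho, pm_difference mu nu rho.
  exists (pm_restr (measurableC mS) mu) => A mA.
  case: (pm_simple_locally_finite mu) => -[X muX] _.
  case: (pm_simple_locally_finite nu) => -[Y nuY] _.
  have YX : Y `<=` X by rewrite -(support_atoms muX) -(support_atoms nuY).
  rewrite /= /mrestr muX ?nuY ?muX//; last first.
    by apply: measurableI => //; exact: measurableC.
  rewrite (support_atoms nuY) [X in _ = X - _](esumID Y)//.
  rewrite (setIidr YX) addeC addeK; last first.
    rewrite -nuY// ge0_fin_numE//; apply: le_lt_trans nuT.
    by apply: le_measure; rewrite ?inE.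
  rewrite esum_mkcondr; apply: eq_esum => x _.
  rewrite !diracE in_setI; case: (x \in ~` Y); first by rewrite andbT.
  by rewrite andbF.
by move=> ex; exact: (@xgetPex _ pm_zero _ ex).
Qed.

End simple_point_measures.

Section point_processes.
Context (R : realType) (d : nat).
Context (disp : measure_display) (W : measurableType disp).
Variable P : probability W R.

(* Negligible rather than null, so that it also makes sense for a map that is
   only specified almost surely, such as a difference of point processes. *)
Definition law_abs_cont (d' : measure_display) (T : measurableType d')
    (X Y : W -> T) : Prop :=
  forall A : set T, measurable A ->
    P.-negligible (Y @^-1` A) -> P.-negligible (X @^-1` A).

Lemma law_abs_contP (d' : measure_display) (T : measurableType d')
    (X Y : {RV P >-> T}) :
  law_abs_cont X Y <-> distribution P X `<< distribution P Y.
Proof.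
have mpre (V : {RV P >-> T}) A : measurable A -> measurable (V @^-1` A).
  by move=> mA; rewrite -[X in measurable X]setTI; exact: measurable_funP.
rewrite null_content_dominatesP; split=> XY A mA.
  move=> YA; apply: (measure_negligible (mpre X A mA)).
  by apply: XY => //; apply/negligibleP; [exact: mpre|exact: YA].
move=> /(measure_negligible (mpre Y A mA)) YA.
by apply/negligibleP; [exact: mpre|exact: XY].
Qed.

(* f is a version of the conditional probability of E given sigma(Y). *)
Definition cond_prob_version (d' : measure_display) (T : measurableType d')
    (E : set W) (Y : W -> T) (f : W -> R) : Prop :=
  [/\ forall B : set R, measurable B ->
        preimage_set_system setT Y measurable (f @^-1` B),
      P.-integrable setT (EFin \o f)
    & forall B : set T, measurable B ->
        \int[P]_(w in Y @^-1` B) (f w)%:E = P (E `&` Y @^-1` B)].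

(* Some version; two versions agree almost surely. *)
Definition cond_prob (d' : measure_display) (T : measurableType d')
    (E : set W) (Y : W -> T) : W -> R :=
  xget (cst 0%R) [set f | cond_prob_version E Y f].

Implicit Types (Pi F : {RV P >-> point_measure R d}).
Implicit Types (Z : {RV P >-> euclid R d}).

Definition as_nonempty Pi : Prop := {ae P, forall w, 0 < Pi w setT}.

Definition process_point Pi Z : Prop :=
  {ae P, forall w, support (Pi w) (Z w)}.

Definition finite_subprocess Pi F : Prop :=
  {ae P, forall w, F w setT < +oo /\ support (F w) `<=` support (Pi w)}.

Definition deletion_tolerant Pi : Prop :=
  forall Z, process_point Pi Z ->
    law_abs_cont (fun w => pm_sub (Pi w) (pm_dirac (Z w))) Pi.

(* If Pi is empty with positive probability, no Z satisfies process_point Pi Z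
   and deletion_tolerant Pi is void.  In the following variant Z is only
   constrained where Pi has a point, and nothing is deleted elsewhere. *)
Definition process_point_if_any Pi Z : Prop :=
  {ae P, forall w, 0 < Pi w setT -> support (Pi w) (Z w)}.

Definition pm_delete (mu : point_measure R d) (z : euclid R d) :=
  if z \in support mu then pm_sub mu (pm_dirac z) else mu.

Definition deletion_tolerant_if_any Pi : Prop :=
  forall Z, process_point_if_any Pi Z ->
    law_abs_cont (fun w => pm_delete (Pi w) (Z w)) Pi.

Lemma deletion_tolerant_if_anyP Pi : as_nonempty Pi ->
  deletion_tolerant_if_any Pi <-> deletion_tolerant Pi.
Proof.
move=> Pi0.
have point Z : process_point_if_any Pi Z <-> process_point Pi Z.
  split=> h; last by apply: filterS h => w.
  by apply: filterS2 Pi0 h => w w0; exact.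
split=> tol Z ptZ A mA PiA.
- have := tol Z ((point Z).2 ptZ) A mA PiA.
  move=> NA; have := negligibleU NA ptZ; apply: negligibleS => w.
  rewrite /preimage/= /pm_delete => Aw.
  have [ptw|] := pselect (support (Pi w) (Z w)); last by right.
  by left; rewrite mem_set.
- have {}ptZ := (point Z).1 ptZ.
  have := negligibleU (tol Z ptZ A mA PiA) ptZ; apply: negligibleS => w.
  rewrite /preimage/= /pm_delete.
  have [ptw|] := pselect (support (Pi w) (Z w)); last by right.
  by rewrite mem_set//; left.
Qed.

Definition finite_deletion_tolerant Pi : Prop :=
  forall F, finite_subprocess Pi F ->
    law_abs_cont (fun w => pm_sub (Pi w) (F w)) Pi.

Definition outside (S : set (euclid R d)) (mS : measurable S) Pi :
    W -> point_measure R d :=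
  fun w => pm_restr (measurableC mS) (Pi w).

Definition erasure_tolerant Pi : Prop :=
  forall (S : set (euclid R d)) (mS : measurable S), bounded_subset S ->
    law_abs_cont (outside mS Pi) Pi.

Definition void_cond_prob_positive Pi : Prop :=
  forall (S : set (euclid R d)) (mS : measurable S), bounded_subset S ->
    {ae P, forall w,
      (0 < cond_prob [set w' | Pi w' S = 0%E] (outside mS Pi) w)%R}.

End point_processes.

(* Main.v *)
From HB Require Import structures.
From Pilot Require Import Defs.
From mathcomp Require Import all_boot all_order all_algebra.
From mathcomp Require Import all_classical all_reals all_analysis.
From mathcomp Require Import measurable_realfun.
(* The algebraic hierarchy also exports a notation named support; this import
   makes the name denote the set of points of a measure. *)
Import Pilot.Defs.

Local Open Scope classical_set_scope.
Local Open Scope ring_scope.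
Local Open Scope ereal_scope.

Set Implicit Arguments.
Unset Strict Implicit.
Unset Printing Implicit Defensive.
Import Order.TTheory GRing.Theory Num.Theory.
Import numFieldNormedType.Exports.

(** A measurable event about a simple point measure depends only on its
    support, and deleting points means removing them from the support.  By
    local finiteness every point x of a point measure mu is isolated by one
    of the countably many rational balls B: x is the only point of mu in B,
    so that deleting x has the same effect as erasing B.

    Deletion tolerance implies that finite deletions preserve null events:
    fix a null event A and a rational ball B.  On the event that Pi has
    exactly one point in B, that point can be completed to a measurable point
    Z of Pi (select), so almost surely erasing B does not lead into A.  Taking
    the union over all balls, the event one_deletion A that some single
    deletion leads into A is again null.  Iterating k times, the event that k
    deletions lead into A is null, and Pi - F in A is covered by the union of
    these events over k (iter_one_deletion).  Everything happens on the given
    probability space: only points that are functions of Pi are used.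

    Erasing a bounded S is the deletion of the finite subprocess formed by the
    points in S.  Conversely, for an arbitrary point Z, the event that Pi
    without Z lies in A is covered by the countably many events that Pi with a
    rational ball erased lies in A.

    Finally, let f be the conditional probability that S is void given what
    happens outside S.  For an event A about the outside, the integral of f
    over A is the probability that A holds and S is void; on the void event Pi
    and its restriction outside S agree.  If f is positive and A is null
    for Pi, the integral vanishes and so A is null outside S.  If erasure
    is tolerated, take A to be the event that f is nonpositive and S is void:
    it is null for Pi, hence for the restriction, which always leaves S
    void. *)

(** * Simple point measures and their supports *)

Section supports.
Context (R : realType) (d : nat).
Local Notation E := (euclid R d).
Local Notation pm := (point_measure R d).
Implicit Types (mu nu : pm) (A B S : set E).

Lemma support_sum mu A : measurable A -> mu A = \esum_(x in support mu) \d_x A.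
Proof.
have [[X muX] _] := pm_simple_locally_finite mu.
by rewrite (support_atoms muX); exact: muX.
Qed.

Lemma mass_eq0P mu A : measurable A ->
  mu A = 0 <-> support mu `&` A = set0.
Proof.
move=> mA; split=> [muA0|muA0].
- apply/seteqP; split=> // x [mux Ax].
  have : mu [set x] <= mu A.
    apply: le_measure; rewrite ?inE//; first exact: measurable_singleton.
    by move=> _ ->.
  by rewrite mux muA0 lee_fin ler10.
- rewrite support_sum// esum1// => x mux.
  rewrite diracE memNset// => Ax.
  by have : set0 x by rewrite -muA0.
Qed.

Lemma mass_eq1P mu A : measurable A ->
  mu A = 1 <-> exists x, support mu `&` A = [set x].
Proof.
move=> mA; split=> [muA1|[x muAx]].
- have [x [mux Ax]] : support mu `&` A !=set0.
    apply/set0P/eqP => /(mass_eq0P mu mA)/eqP.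
    by rewrite muA1 onee_eq0.
  exists x.
  have m1 : measurable [set x] by exact: measurable_singleton.
  have AD : mu A = mu (A `\ x) + mu [set x].
    rewrite -measureU//; first by rewrite setUC setDUK// => _ ->.
      exact: measurableD.
    by apply/seteqP; split=> // y [[_ yx] /yx].
  have : mu (A `\ x) = 0.
    by rewrite mux in AD; rewrite -[LHS](@addeK _ 1)// -AD muA1 subee.
  move=> /(mass_eq0P mu (measurableD mA m1)) D0.
  apply/seteqP; split=> [y [muy Ay]|_ ->]//; apply: contrapT => yx.
  by have : set0 y by rewrite -D0.
- rewrite support_sum// (esumID A)// muAx esum_set1//.
    have [_ Ax] : (support mu `&` A) x by rewrite muAx.
    rewrite diracE mem_set// esum1 ?adde0// => y [_ Ay].
    by rewrite diracE memNset.
Qed.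

Lemma support_restr mu S (mS : measurable S) :
  support (pm_restr mS mu) = support mu `&` S.
Proof.
rewrite /support/=; apply/seteqP; split=> x /=.
- rewrite /mrestr => mux.
  have m1 : measurable [set x] by exact: measurable_singleton.
  have Sx : S x.
    apply: contrapT => nSx; move: mux; rewrite (_ : _ `&` _ = set0).
      by rewrite measure0 => /eqP; rewrite eq_sym onee_eq0.
    by apply/seteqP; split=> // y [->].
  by split=> //; rewrite -mux; congr (mu _); apply/seteqP; split=> [_ ->|y []].
- move=> [mux Sx]; rewrite /mrestr -mux; congr (mu _).
  by apply/seteqP; split=> [y []|_ ->].
Qed.

Lemma support_dirac (x : E) : support (pm_dirac x) = [set x].
Proof. by apply: support_atoms => A mA; rewrite esum_set1. Qed.

Lemma mass_atom mu (x : E) : mu [set x] = (x \in support mu)%:R%:E.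
Proof.
have m1 : measurable [set x] by exact: measurable_singleton.
have [mux|nmux] := pselect (support mu x); first by rewrite mem_set.
rewrite memNset//; apply/(mass_eq0P mu m1)/seteqP.
by split=> // y [/[swap] ->].
Qed.

Lemma support_sub mu nu : nu setT < +oo -> support nu `<=` support mu ->
  support (pm_sub mu nu) = support mu `\` support nu.
Proof.
move=> nuT numu; apply/seteqP; split=> x.
- rewrite {1}/support/= (pm_subP nuT numu); last exact: measurable_singleton.
  rewrite !mass_atom.
  have [nux|nnux] := pselect (support nu x).
    rewrite mem_set; last exact: numu.
    by rewrite mem_set// subee// => /eqP; rewrite eq_sym onee_eq0.
  rewrite (memNset nnux) sube0; have [//|nmux] := pselect (support mu x).
  by rewrite memNset// => /eqP; rewrite eq_sym onee_eq0.
- move=> [mux nnux].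
  rewrite /support/= (pm_subP nuT numu); last exact: measurable_singleton.
  by rewrite !mass_atom mem_set// memNset// sube0.
Qed.

(** The events about mu are generated by the masses of Borel sets, and such a
    mass counts the points of the support.  This is what allows all the
    deletions below to be compared through supports alone, although they are
    different functions on non-Borel sets. *)
Lemma measurable_support (C : set pm) mu nu : measurable C ->
  support mu = support nu -> C mu -> C nu.
Proof.
move=> mC mn; suff: C mu <-> C nu by case.
have : measurable `<=` [set C : set pm | C mu <-> C nu].
  apply: smallest_sub.
    split=> [||F hF]//=.
    - by move=> B hB; split=> -[_ h]; split=> // /hB.
    - by split=> -[i _ /hF]; exists i.
  move=> _ [A mA [B mB <-]] /=; rewrite /preimage/=.
  by rewrite (support_sum mu)// (support_sum nu)// mn.
exact.
Qed.

Lemma measurable_mass A : measurable A ->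
  measurable_fun setT (fun mu : pm => mu A).
Proof.
move=> mA _ B mB; apply: sub_sigma_algebra.
by exists A => //; exists B.
Qed.

Lemma measurable_mass_eq A (c : \bar R) : measurable A ->
  measurable [set mu : pm | mu A = c].
Proof.
move=> mA; rewrite -[X in measurable X]setTI.
exact: (measurable_mass mA measurableT (emeasurable_set1 c)).
Qed.

Lemma measurable_restr S (mS : measurable S) :
  measurable_fun setT (pm_restr mS).
Proof.
apply: (measurability (\bigcup_(A in @measurable _ E)
  preimage_set_system [set: pm] (fun mu : pm => mu A)
    (measurable : set (set (\bar R)))) erefl).
move=> _ [_ [A mA [B mB <-]] <-].
rewrite !setTI -[X in measurable X]setTI.
exact: (measurable_mass (measurableI _ _ mA mS) measurableT mB).
Qed.

(** The pickling of centres and radii makes the family a sequence; indices that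
    encode no ball give the empty set.  Radii are at most 1, so that all the
    balls are bounded. *)
Definition rat_ball (n : nat) : set E :=
  if unpickle n is Some (q, k) then
    (ball (map_mx ratr q : 'rV[R]_d) (k.+1%:R^-1)%R : set 'rV[R]_d)
  else set0.

Lemma measurable_rat_ball n : measurable (rat_ball n).
Proof.
rewrite /rat_ball; case: unpickle => [[q k]|]; last exact: measurable0.
by apply: sub_sigma_algebra; exact: ball_open.
Qed.

Lemma rat_ball_bounded n : bounded_subset (rat_ball n).
Proof.
rewrite /rat_ball /bounded_subset; case: unpickle => [[q k]|].
  exists (`|map_mx ratr q : 'rV[R]_d| + k.+1%:R^-1)%R; split=> // M qM x.
  rewrite -ball_normE/= => qx.
  have -> : x = (map_mx ratr q - (map_mx ratr q - x))%R by rewrite subKr.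
  by rewrite (le_trans (ler_normB _ _))// (le_trans _ (ltW qM))// lerD2l ltW.
by exists 0%R; split=> // M _ x.
Qed.

Lemma rat_ball_basis (x : E) (U : set E) :
  nbhs (x : 'rV[R]_d) (U : set 'rV[R]_d) ->
  exists n, rat_ball n x /\ rat_ball n `<=` U.
Proof.
move=> /nbhs_ballP[e /= e0 eU].
(* A ball of radius e / 2 that contains x lies in the ball of radius e. *)
have [k ke] : exists k, (k.+1%:R^-1 < e / 2)%R.
  have /ltr_add_invr[k] : (0 < e / 2)%R by rewrite divr_gt0.
  by rewrite add0r; exists k.
have [q qx] : exists q : 'rV[rat]_d,
    ball (map_mx ratr q : 'rV[R]_d) (k.+1%:R^-1)%R x.
  have k0 : (0 < k.+1%:R^-1 :> R)%R by rewrite invr_gt0.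
  pose xj j := (x : 'rV[R]_d) ord0 j.
  have qP j : {r : rat | ball (ratr r : R) (k.+1%:R^-1)%R (xj j)}.
    apply: cid.
    have /rat_in_itvoo[r] : (xj j < xj j + k.+1%:R^-1)%R.
      by rewrite ltrDl.
    rewrite in_itv/= => /andP[xr rx]; exists r.
    by rewrite -ball_normE/= gtr0_norm ?subr_gt0// ltrBlDl.
  exists (\row_j sval (qP j)); split=> // i j.
  rewrite !mxE; have -> : i = ord0 by exact: ord1.
  by case: (qP j).
exists (pickle (q, k)); rewrite /rat_ball pickleK; split=> // y qy.
apply: eU; apply: (@ball_split _ _ (map_mx ratr q : 'rV[R]_d)).
  by apply/ball_sym; apply: le_ball qx; exact: ltW.
by apply: le_ball qy; exact: ltW.
Qed.

Lemma bounded_finite_support mu A : measurable A -> bounded_subset A ->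
  finite_set (support mu `&` A).
Proof.
move=> mA bA; rewrite -(support_restr mu mA); apply: support_finite.
rewrite /= /mrestr setTI.
exact: (pm_simple_locally_finite mu).2.
Qed.

(** A bounded ball around x contains finitely many other points of mu, and these
    form a closed set, so that a smaller rational ball avoids them. *)
Lemma support_isolated mu (x : E) : support mu x ->
  exists n, support mu `&` rat_ball n = [set x].
Proof.
move=> mux.
have [n [nx _]] := rat_ball_basis (@filterT _ _ (nbhs_filter (x : 'rV[R]_d))).
have fin : finite_set ((support mu `&` rat_ball n) `\ x).
  apply: finite_setD; apply: bounded_finite_support.
    exact: measurable_rat_ball.
  exact: rat_ball_bounded.
have T1 : accessible_space 'rV[R]_d.
  exact: (hausdorff_accessible (@norm_hausdorff R 'rV[R]_d)).
have cl : @closed 'rV[R]_d ((support mu `&` rat_ball n) `\ x).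
  exact: (@accessible_finite_set_closed _).1 T1 _ fin.
have [m [mx mn]] : exists m, rat_ball m x /\
    rat_ball m `<=` rat_ball n `&` ~` ((support mu `&` rat_ball n) `\ x).
  apply: rat_ball_basis; apply: filterI.
    apply: open_nbhs_nbhs; split=> //.
    rewrite /rat_ball; case: unpickle => [[q k]|]; last exact: open0.
    exact: ball_open.
  apply: open_nbhs_nbhs; split; first exact: (closed_openC cl).
  by move=> [_ xx]; exact: xx.
exists m; apply/seteqP; split=> [y [muy /mn[ny my]]|_ ->]//.
by apply: contrapT => yx; exact: my.
Qed.

End supports.

(** * A measurable choice of a point *)

Section selection.
Context (R : realType) (d : nat).
Local Notation E := (euclid R d).
Local Notation pm := (point_measure R d).
Implicit Types (mu : pm) (x : E).
Variable B : nat -> set E.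
Hypothesis mB : forall n, measurable (B n).

Definition single_point_in (S : set E) : set pm := [set mu | mu S = 1].

Lemma measurable_single_point_in S : measurable S ->
  measurable (single_point_in S).
Proof. exact: measurable_mass_eq. Qed.

Definition first_single (n : nat) : set pm :=
  single_point_in (B n) `\` \bigcup_(k in `I_n) single_point_in (B k).

Lemma measurable_first_single n : measurable (first_single n).
Proof.
apply: measurableD; first exact: measurable_single_point_in.
by apply: bigcup_measurable => k _; exact: measurable_single_point_in.
Qed.

(** The point of mu in the first set of the sequence that contains exactly one:
    a rule that uses mu only, hence is available on any probability space that
    carries the process. *)
Definition select mu : E :=
  xget (0%R : 'rV[R]_d)
    [set x | exists2 n, first_single n mu & support mu `&` B n = [set x]].

Lemma select_first n mu : first_single n mu ->
  support mu `&` B n = [set select mu].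
Proof.
move=> Fn.
have [x Bx] := (mass_eq1P mu (mB n)).1 Fn.1.
have : [set x | exists2 n, first_single n mu & support mu `&` B n = [set x]] x.
  by exists n.
rewrite /select => h; case: (xgetPex (0%R : 'rV[R]_d) (ex_intro _ x h)).
move=> m Fm <-; have -> // : n = m.
apply/eqP; rewrite eqn_leq leqNgt [X in _ && X]leqNgt.
apply/andP; split; apply/negP => lt.
  by apply: Fn.2; exists m => //; exact: Fm.1.
by apply: Fm.2; exists n => //; exact: Fn.1.
Qed.

Lemma first_single_exists n mu : single_point_in (B n) mu ->
  exists m, first_single m mu.
Proof.
move=> Bn.
have ex : exists n, `[< single_point_in (B n) mu >] by exists n; exact/asboolP.
case: (ex_minnP ex) => m /asboolP Bm min; exists m; split=> // -[k /= km Bk].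
by have := min k; rewrite leqNgt km => /(_ (asboolT Bk)).
Qed.

(** If B n is the first set with a single point, then the selected point lies in
    C exactly when mu has mass 1 on B n intersected with C, which is a
    measurable condition. *)
Lemma measurable_select : measurable_fun setT select.
Proof.
move=> _ C mC; rewrite setTI.
(* On none, select takes the default value 0. *)
pose none := ~` \bigcup_n single_point_in (B n).
have -> : select @^-1` C =
    \bigcup_n (first_single n `&` single_point_in (B n `&` C)) `|`
    (none `&` [set _ | C (0%R : 'rV[R]_d)]).
  have selC n mu : first_single n mu ->
      C (select mu) <-> single_point_in (B n `&` C) mu.
    move=> Fn; have sB := select_first Fn.
    rewrite /single_point_in/=.
    split=> [Cs|/(mass_eq1P mu (measurableI _ _ (mB n) mC))[x]].
      apply/(mass_eq1P mu (measurableI _ _ (mB n) mC)).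
      exists (select mu); rewrite setIA sB; apply/setIidPl => _ -> //.
    rewrite setIA sB => sCx; suff [] : ([set select mu] `&` C) x by move=> ->.
    by rewrite sCx.
  apply/seteqP; split=> [mu Cmu|mu [[n _ [Fn /(selC n mu Fn).2//]]|[nmu C0]]].
    have [[n _ Bn]|nB] := pselect ((\bigcup_n single_point_in (B n)) mu).
      have [m Fm] := first_single_exists Bn.
      by left; exists m => //; split=> //; apply/selC.
    right; split=> //=; move: Cmu.
    rewrite /preimage/= /select xgetPN// => x [n [Bn _]] _.
    by apply: nB; exists n.
  rewrite /preimage/= /select xgetPN// => x [n [Bn _]] _.
  by apply: nmu; exists n.
apply: measurableU.
  apply: bigcupT_measurable => n; apply: measurableI.
    exact: measurable_first_single.
  by apply: measurable_single_point_in; exact: measurableI.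
have mnone : measurable none.
  apply: measurableC; apply: bigcupT_measurable => n.
  exact: measurable_single_point_in.
have [C0|nC0] := pselect (C (0%R : 'rV[R]_d)).
  rewrite (_ : _ `&` _ = none)//.
  by apply/seteqP; split=> [mu []|mu].
rewrite (_ : _ `&` _ = set0)//.
by apply/seteqP; split=> [mu []|mu].
Qed.
End selection.

(** * Deletion and erasure *)

Section tolerance.
Context (R : realType) (d : nat).
Context (disp : measure_display) (W : measurableType disp).
Variable P : probability W R.
Local Notation E := (euclid R d).
Local Notation pm := (point_measure R d).
Implicit Types (Pi : {RV P >-> pm}) (A : set pm).

Local Notation erase n := (pm_restr (measurableC (@measurable_rat_ball R d n))).

Lemma measurable_RV_preimage (d' : measure_display) (T : measurableType d')
  (X : {RV P >-> T}) (A : set T) : measurable A -> measurable (X @^-1` A).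
Proof.
by move=> mA; rewrite -[X in measurable X]setTI; exact: measurable_funP.
Qed.

Definition one_deletion A : set pm :=
  \bigcup_n (single_point_in (rat_ball n) `&` erase n @^-1` A).

Lemma measurable_one_deletion A : measurable A -> measurable (one_deletion A).
Proof.
move=> mA; apply: bigcupT_measurable => n; apply: measurableI.
  apply: measurable_single_point_in; exact: measurable_rat_ball.
rewrite -[X in measurable X]setTI.
exact: (measurable_restr (measurableC (@measurable_rat_ball R d n))).
Qed.

Lemma support_erase n (mu : pm) x : support mu `&` rat_ball n = [set x] ->
  support (erase n mu) = support mu `\ x.
Proof.
by move=> sx; rewrite support_restr -sx setDE setCI setIUr setICr set0U.
Qed.

Lemma support_pm_delete (mu : pm) x :
  support (pm_delete mu x) = support mu `\ x.
Proof.
rewrite /pm_delete; case: ifPn => [/set_mem mux|/negP nmux].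
  rewrite support_sub ?support_dirac//; first by rewrite /= diracT ltry.
  by move=> _ ->.
apply/seteqP; split=> [y muy|y []//]; split=> // yx.
by apply: nmux; rewrite -yx mem_set.
Qed.

(** Deletion tolerance speaks of one random point, whereas one_deletion allows
    any point.  The countably many selections below exhaust all points: the
    m-th one is the point in rat_ball m whenever there is exactly one there. *)
Lemma one_deletion_negligible Pi A : deletion_tolerant_if_any Pi ->
  measurable A -> P.-negligible (Pi @^-1` A) ->
  P.-negligible (Pi @^-1` one_deletion A).
Proof.
move=> tol mA negA; rewrite preimage_bigcup.
apply: negligible_bigcup => m.
(* The m-th ball comes first; the others serve to select some point of Pi when
   the m-th ball does not contain exactly one. *)
pose B n : set E := if n is k.+1 then rat_ball k else rat_ball m.
have mB n : measurable (B n) by case: n => [|n]; exact: measurable_rat_ball.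
have mZ : measurable_fun setT (select B \o Pi).
  apply: (measurableT_comp (measurable_select mB)).
  exact: measurable_funP.
pose Z : {RV P >-> E} := HB.pack (select B \o Pi)
   (isMeasurableFun.Build _ _ _ _ _ mZ).
have ZPi : process_point_if_any Pi Z.
  apply: aeW => w Piw.
  have [x Pix] : support (Pi w) !=set0.
    apply/set0P/eqP => s0; move: Piw.
    rewrite (mass_eq0P (Pi w) measurableT).2 ?ltxx//.
    by rewrite s0 set0I.
  have [n sn] := support_isolated Pix.
  have Bn : single_point_in (B n.+1) (Pi w).
    by apply/(mass_eq1P (Pi w) (mB n.+1)); exists x.
  have [k Fk] := first_single_exists Bn.
  suff [] : (support (Pi w) `&` B k) (select B (Pi w)) by [].
  by rewrite (select_first mB Fk).
apply: negligibleS (tol Z ZPi A mA negA) => w [/= sm].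
have F0 : first_single B 0 (Pi w) by split=> // -[].
have sB := select_first mB F0.
rewrite /preimage/=; apply: measurable_support => //.
by rewrite support_pm_delete (support_erase sB).
Qed.

Lemma set_seq_cons (T : eqType) (x : T) (s : seq T) :
  [set` x :: s] = [set x] `|` [set` s].
Proof.
apply/seteqP; split=> y /=; rewrite inE.
  by move=> /orP[/eqP|]; [left|right].
by move=> [->|ys]; rewrite ?eqxx ?ys ?orbT.
Qed.

(** The list s may contain repetitions and elements that are not points of mu;
    the latter need no deletion, so the number of iterations k can be smaller
    than the length of s. *)
Lemma iter_one_deletion (s : seq E) (mu nu : pm) A : measurable A ->
  support nu = support mu `\` [set` s] -> A nu ->
  exists k, iter k one_deletion A mu.
Proof.
elim: s A nu => [|x s IH] A nu mA.
  rewrite set_nil setD0 => numu Anu; exists 0%N.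
  exact: measurable_support numu Anu.
rewrite set_seq_cons setUC -setDDl => numu Anu.
have ms : measurable [set` s].
  exact: (countable_measurable (@measurable_singleton R d)
    (finite_set_countable (finite_seq s))).
pose rho := pm_restr (measurableC ms) mu.
have rhoE : support rho = support mu `\` [set` s] by rewrite support_restr.
rewrite -rhoE in numu.
have [rhox|nrhox] := pselect (support rho x); last first.
  apply: (IH A nu) => //; rewrite numu -rhoE.
  apply/seteqP; split=> [y []//|y rhoy]; split=> // yx.
  by apply: nrhox; rewrite -yx.
have [n sn] := support_isolated rhox.
have [k Dk] : exists k, iter k one_deletion (one_deletion A) mu.
  apply: (IH _ rho) => //; first exact: measurable_one_deletion.
  exists n => //; split.
    by apply/mass_eq1P; [exact: measurable_rat_ball|exists x].
  by apply: (measurable_support mA _ Anu); rewrite numu (support_erase sn).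
by exists k.+1; rewrite iterSr.
Qed.

(** Only null events are moved along the iteration, never the laws: that Pi - F
    is reached from Pi by k deletions, k random, is a statement about each
    outcome, and F need not be measurable with respect to Pi. *)
Lemma deletion_tolerant_if_any_finite Pi :
  deletion_tolerant_if_any Pi -> finite_deletion_tolerant Pi.
Proof.
move=> tol F subF A mA negA.
have neg k : measurable (iter k one_deletion A) /\
    P.-negligible (Pi @^-1` iter k one_deletion A).
  elim: k => [//|k [mk negk]]; split; first exact: measurable_one_deletion.
  exact: one_deletion_negligible.
apply: negligibleS (negligibleU subF (negligible_bigcup (fun k => (neg k).2))).
move=> w Aw; have [[Ffin FPi]|] := pselect (F w setT < +oo /\
    support (F w) `<=` support (Pi w)); last by left.
right; have /finite_seqP[s sE] := support_finite Ffin.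
have := support_sub Ffin FPi; rewrite sE => subE.
by have [k Dk] := iter_one_deletion mA subE Aw; exists k.
Qed.

Lemma finite_deletion_tolerant_erasure Pi :
  finite_deletion_tolerant Pi -> erasure_tolerant Pi.
Proof.
move=> tol S mS bS A mA negA.
have mF : measurable_fun setT (pm_restr mS \o Pi).
  by apply: (measurableT_comp (measurable_restr mS)); exact: measurable_funP.
pose F : {RV P >-> pm} := HB.pack (pm_restr mS \o Pi)
   (isMeasurableFun.Build _ _ _ _ _ mF).
have Ffin w : F w setT < +oo.
  by rewrite /= /mrestr setTI; exact: (pm_simple_locally_finite (Pi w)).2.
have FPi w : support (F w) `<=` support (Pi w).
  by rewrite support_restr; exact: subIsetl.
have subF : finite_subprocess Pi F by apply: aeW => w.
apply: negligibleS (tol F subF A mA negA) => w.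
apply: measurable_support => //.
rewrite (support_sub (Ffin w) (FPi w)) !support_restr.
by rewrite setDE setCI setIUr setICr set0U.
Qed.

(** The random point Z is isolated by a ball that depends on the outcome, but
    there are countably many choices. *)
Lemma erasure_tolerant_deletion Pi :
  erasure_tolerant Pi -> deletion_tolerant_if_any Pi.
Proof.
move=> tol Z _ A mA negA.
have neg n : P.-negligible (outside (@measurable_rat_ball R d n) Pi @^-1` A).
  by apply: tol => //; exact: rat_ball_bounded.
apply: negligibleS (negligibleU negA (negligible_bigcup neg)) => w Aw.
have [Piz|nPiz] := pselect (support (Pi w) (Z w)); last first.
  by left; move: Aw; rewrite /preimage/= /pm_delete memNset.
right; have [n sn] := support_isolated Piz; exists n => //.
apply: measurable_support Aw => //.
by rewrite support_pm_delete (support_erase sn).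
Qed.

Lemma outside_eq (S : set E) (mS : measurable S) Pi w (A : set pm) :
  measurable A -> Pi w S = 0 -> A (Pi w) <-> A (outside mS Pi w).
Proof.
move=> mA /(mass_eq0P (Pi w) mS) s0.
have sE : support (Pi w) = support (outside mS Pi w).
  by rewrite support_restr -setDE; apply/esym/setDidPl.
by split; apply: measurable_support.
Qed.

End tolerance.

(** * Conditional void probabilities *)

Section conditional_probability.
Context (R : realType) (disp : measure_display) (W : measurableType disp).
Context (P : probability W R) (d' : measure_display) (T : measurableType d').

(** The joint law of E and Y is dominated by the law of Y; composing its
    Radon-Nikodym density with Y gives a version. *)
Lemma cond_probP (E : set W) (Y : {RV P >-> T}) : measurable E ->
  cond_prob_version P E Y (cond_prob P E Y).
Proof.
move=> mE.
suff [f fP] : exists f, cond_prob_version P E Y f.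
  exact: (@xgetPex _ (cst 0%R) [set f | cond_prob_version P E Y f]
    (ex_intro _ f fP)).
pose law := distribution P Y.
(* push expects a proof that Y is measurable. *)
pose push : {measure set T -> \bar R} := pushforward (mrestr P mE) Y.
pose joint0 := push (measurable_funPT Y).
have joint_fin : fin_num_fun joint0.
  move=> B mB; rewrite /joint0/= /pushforward /mrestr fin_num_measure//.
  by apply: measurableI => //; exact: measurable_RV_preimage.
pose joint : {finite_measure set T -> \bar R} :=
  HB.pack (joint0 : set T -> \bar R) joint0
    (Measure_isFinite.Build _ _ _ (joint0 : set T -> \bar R) joint_fin).
have joint_dom : joint `<< law.
  apply/null_content_dominatesP => B mB lawB.
  apply/eqP; rewrite -measure_le0 -lawB.
  rewrite /joint /joint0 /law/= /pushforward /mrestr/= le_measure// ?inE.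
  - by apply: measurableI => //; exact: measurable_RV_preimage.
  - exact: measurable_RV_preimage.
have [g [g0 gfin gint gE]] := radon_nikodym_sigma_finite joint_dom.
have mg : measurable_fun setT g by exact: measurable_int gint.
have gY w : ((fine \o g \o Y) w)%:E = g (Y w) by rewrite /= fineK.
exists (fine \o g \o Y); split.
- move=> B mB; exists ((fine \o g) @^-1` B); last by rewrite setTI.
  rewrite -[X in measurable X]setTI.
  by apply: measurableT_comp => //; exact: measurable_fine.
- apply/integrableP; split.
    do 2 apply: measurableT_comp => //.
    by apply: measurableT_comp => //; exact: measurable_fine.
  rewrite (eq_integral (g \o Y)); last first.
    by move=> w _; rewrite [(EFin \o _) w]gY gee0_abs.
  rewrite -(ge0_integral_distribution Y mg g0).
  have := gE _ measurableT; rewrite /law => <-.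
  by rewrite ltey_eq joint_fin.
- move=> B mB.
  under eq_integral do rewrite gY.
  have := gE _ mB; rewrite /joint/= /joint0/= /pushforward /mrestr setIC => ->.
  by rewrite /law/= ge0_integral_pushforward//; exact: measurable_funTS.
Qed.
End conditional_probability.

Section void_probabilities.
Context (R : realType) (d : nat).
Context (disp : measure_display) (W : measurableType disp).
Variable P : probability W R.
Local Notation pm := (point_measure R d).
Implicit Types (Pi : {RV P >-> pm}) (S : set (euclid R d)).

Lemma measurable_void Pi S : measurable S ->
  measurable [set w | Pi w S = 0].
Proof.
move=> mS; apply: (measurable_RV_preimage Pi (A := [set mu : pm | mu S = 0])).
exact: measurable_mass_eq.
Qed.

Lemma measurable_outside Pi S (mS : measurable S) :
  measurable_fun setT (outside mS Pi).
Proof.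
apply: (measurableT_comp (measurable_restr (measurableC mS))).
exact: measurable_funP.
Qed.

Lemma void_cond_probP Pi S (mS : measurable S) :
  cond_prob_version P [set w | Pi w S = 0] (outside mS Pi)
    (cond_prob P [set w | Pi w S = 0] (outside mS Pi)).
Proof.
pose Y : {RV P >-> pm} := HB.pack (outside mS Pi)
  (isMeasurableFun.Build _ _ _ _ _ (measurable_outside Pi mS)).
exact: (@cond_probP _ _ _ P _ _ _ Y (measurable_void Pi mS)).
Qed.

Lemma erasure_tolerant_void Pi :
  erasure_tolerant Pi -> void_cond_prob_positive Pi.
Proof.
move=> tol S mS bS.
have [fY fint fE] := void_cond_probP Pi mS.
set f := cond_prob _ _ _ in fY fint fE *.
have [A mA fA] := fY _ (measurable_itv `]-oo, 0%R]).
rewrite setTI in fA.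
have mYA : measurable (outside mS Pi @^-1` A).
  by rewrite -[X in measurable X]setTI; exact: measurable_outside.
have mvoidYA : measurable ([set w | Pi w S = 0] `&` outside mS Pi @^-1` A).
  by apply: measurableI => //; exact: measurable_void.
have null : P ([set w | Pi w S = 0] `&` outside mS Pi @^-1` A) = 0.
  apply/eqP; rewrite -measure_le0; have := fE _ mA => /= <-.
  rewrite -(integral0 P (outside mS Pi @^-1` A)); apply: le_integral => //.
  - exact: integrableS fint.
  - exact: integrable0.
  - by move=> w /set_mem; rewrite fA /= in_itv/= lee_fin.
(* For Pi this event requires S to be void, and then Pi agrees with its
   restriction; for the restriction the second condition always holds. *)
have : P.-negligible (outside mS Pi @^-1` (A `&` [set mu : pm | mu S = 0])).
  apply: tol => //.
    by apply: measurableI => //; exact: measurable_mass_eq.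
  apply: negligibleS ((negligibleP P mvoidYA).2 null) => w [Aw Sw].
  by split=> //; apply/(outside_eq mS mA Sw).
apply: negligibleS => w /= /negP; rewrite -leNgt => fw0.
suff Aw : (outside mS Pi @^-1` A) w.
  by split=> //; rewrite /= /mrestr setICr measure0.
by rewrite fA /= in_itv.
Qed.

Lemma void_cond_prob_positive_erasure Pi :
  void_cond_prob_positive Pi -> erasure_tolerant Pi.
Proof.
move=> pos S mS bS A mA negA.
have [fY fint fE] := void_cond_probP Pi mS.
have f0 := pos S mS bS.
set f := cond_prob _ _ _ in fY fint fE f0.
have mYA : measurable (outside mS Pi @^-1` A).
  by rewrite -[X in measurable X]setTI; exact: measurable_outside.
have mvoidYA : measurable ([set w | Pi w S = 0] `&` outside mS Pi @^-1` A).
  by apply: measurableI => //; exact: measurable_void.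
have null : P ([set w | Pi w S = 0] `&` outside mS Pi @^-1` A) = 0.
  apply: measure_negligible => //.
  by apply: negligibleS negA => w [Sw Aw]; apply/(outside_eq mS mA Sw).
have mf : measurable_fun (outside mS Pi @^-1` A) (EFin \o f).
  by apply: measurable_funTS; exact: measurable_int fint.
(* The integrand is positive almost surely, so that a zero integral leaves
   almost no room for the set of integration. *)
have absf : \int[P]_(w in outside mS Pi @^-1` A) `|(EFin \o f) w| = 0.
  rewrite -null -fE//; apply: ae_eq_integral => //.
    exact: measurableT_comp.
  by apply: filterS f0 => w fw _; rewrite gee0_abs// lee_fin ltW.
have /(ae_eq_integral_abs P mYA mf).1 := absf => aef.
have := negligibleU f0 aef; apply: negligibleS => w Aw.
have [fw|] := pselect (0 < f w)%R; last by left.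
by right => /(_ Aw)[] /eqP; rewrite gt_eqF.
Qed.
End void_probabilities.

(** * Equivalence of the four conditions *)

Theorem theorem1 (R : realType) (d : nat)
    (disp : measure_display) (W : measurableType disp) (P : probability W R)
    (Pi : {RV P >-> point_measure R d}) :
  (as_nonempty Pi ->
    [<-> deletion_tolerant Pi;
         finite_deletion_tolerant Pi;
         erasure_tolerant Pi;
         void_cond_prob_positive Pi])
  /\
    [<-> deletion_tolerant_if_any Pi;
         finite_deletion_tolerant Pi;
         erasure_tolerant Pi;
         void_cond_prob_positive Pi].
Proof.
have finite := @deletion_tolerant_if_any_finite _ _ _ _ _ Pi.
have erasure := @finite_deletion_tolerant_erasure _ _ _ _ _ Pi.
have void := @erasure_tolerant_void _ _ _ _ _ Pi.
have back : void_cond_prob_positive Pi -> deletion_tolerant_if_any Pi.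
  move=> /void_cond_prob_positive_erasure.
  exact: erasure_tolerant_deletion.
split; last by tfae.
move=> Pi0; have tolP := deletion_tolerant_if_anyP Pi0.
by tfae => // [/tolP.2|/back/tolP.1].
Qed.
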